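(* Consider symmetric tries: $|\mathcal A|=r$ and $p_\alpha=1/r$ for all $\alpha\in\mathcal A$, and assume that $r,k\ge2$ are integers. Let $$f_{\mathsf E;k\text{-prot},r}(\lambda):=\mathbb P\bigl(\widetilde{\mathcal T}_\lambda\ne\emptyset\text{ and the root of }\widetilde{\mathcal T}_\lambda\text{ is }k\text{-protected}\bigr),\qquad f_{\mathsf E;k\text{-prot},r}^*(-1)=\int_0^\infty f_{\mathsf E;k\text{-prot},r}(\lambda)\lambda^{-2}\,d\lambda.$$ As $k\to\infty$ or $r\to\infty$ (or both), $$f_{\mathsf E;k\text{-prot},r}^*(-1)\sim\frac{1}{2r^{k-1}}.$$ In particular, for symmetric binary tries ($r=2$), as $k\to\infty$, $$f_{\mathsf E;k\text{-prot},2}^*(-1)\sim2^{-k}.$$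
   Context: Strings. $\mathcal A$ is a finite alphabet with $r=|\mathcal A|\ge2$ letters; $\mathcal A^*=\bigcup_{m\ge0}\mathcal A^m$ is the set of finite strings, with empty string $\epsilon$. $\Xi^{(1)},\Xi^{(2)},\dots$ are i.i.d. random infinite strings, each with i.i.d. letters uniformly distributed on $\mathcal A$. Tries. Given a set of $n$ distinct infinite strings, let $\nu_{\boldsymbol\alpha}$ be the number of them having prefix $\boldsymbol\alpha\in\mathcal A^*$. The trie they generate is the empty tree $\emptyset$ if $n=0$; otherwise it is the finite rooted tree (root $\epsilon$, the children of $\boldsymbol\alpha$ being the nodes $\boldsymbol\alpha\gamma$, $\gamma\in\mathcal A$) whose nodes are all $\boldsymbol\alpha\in\mathcal A^*$ with either $\nu_{\boldsymbol\alpha}\ge2$ (internal nodes), or $\nu_{\boldsymbol\alpha}=1$ and $\boldsymbol\alpha=\epsilon$ or the parent of $\boldsymbol\alpha$ is an internal node (external nodes = leaves). The rank of a node $v$ is the minimum distance from $v$ to a descendant of $v$ that is a leaf (a leaf has rank $0$); a node is $k$-protected if its rank is $\ge k$. For $\lambda>0$, $N_\lambda\sim\mathrm{Po}(\lambda)$ is independent of the strings and $\widetilde{\mathcal T}_\lambda$ is the random trie generated by $\Xi^{(1)},\dots,\Xi^{(N_\lambda)}$. The limit ''$k\to\infty$ or $r\to\infty$ (or both)'' means along any sequence of pairs $(r,k)$ of integers $\ge2$ with $\max(r,k)\to\infty$ (equivalently $r^{k-1}\to\infty$); $a\sim b$ means $a/b\to1$. The number $f^*_{\mathsf E;k\text{-prot},r}(-1)$,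 divided by $1+\log r$, is, ignoring oscillations, the asymptotic proportion of $k$-protected nodes in a random symmetric trie. *)

(* Defs.v *)
From HB Require Import structures.
From mathcomp Require Import all_boot all_order all_algebra.
From mathcomp Require Import all_classical all_reals all_analysis.

Set Implicit Arguments.
Unset Strict Implicit.
Unset Printing Implicit Defensive.

Import Order.TTheory GRing.Theory Num.Theory.
Import numFieldNormedType.Exports.

Local Open Scope classical_set_scope.
Local Open Scope ring_scope.

Section Trie.
Context (A : finType) (n : nat) (x : 'I_n -> nat -> A).
Implicit Types v : seq A.

Definition has_prefix v (s : nat -> A) : bool := v == mkseq s (size v).

(* Strings are counted by index, which is the number of strings with prefix
   [v] when the [x i] are pairwise distinct. *)
Definition nu v : nat := #|[pred i | has_prefix v (x i)]|.

Definition parent v : seq A := take (size v).-1 v.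

Definition internal_node v : bool := (2 <= nu v)%N.

Definition external_node v : bool :=
  (nu v == 1)%N && ((v == [::]) || internal_node (parent v)).

Definition trie : set (seq A) := [set v | internal_node v || external_node v].

(* The descendants of [v] are the [v ++ u], at distance [size u]; the leaves
   are the external nodes. *)
Definition leaf_distances v : set nat :=
  [set size u | u in [set u | external_node (v ++ u)]].

Definition is_rank v (m : nat) : Prop :=
  leaf_distances v m /\ (forall m', leaf_distances v m' -> (m <= m')%N).

(* If strings coincide, a node may have no leaf below it, hence no rank; it is
   then not protected. For random strings this has probability 0. *)
Definition protected (k : nat) v : Prop := exists2 m, is_rank v m & (k <= m)%N.

End Trie.

Section Model.
Context (R : realType) d (Omega : measurableType d) (P : probability Omega R).

Definition independent_systems (I : eqType) (G : I -> set_system Omega) :=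
  forall (s : seq I) (B : I -> set Omega), uniq s ->
    (forall i, i \in s -> G i (B i)) ->
    P (\bigcap_(i in [set` s]) B i) = (\prod_(i <- s) P (B i))%E.

Context (A : finType).

Definition letter_events (X : Omega -> nat -> A) (m : nat) : set_system Omega :=
  [set (fun w => X w m) @^-1` B | B in [set: set A]].

Definition string_events (X : Omega -> nat -> A) : set_system Omega :=
  <<s \bigcup_m letter_events X m >>.

Definition family_events (Xi : nat -> Omega -> nat -> A) : set_system Omega :=
  <<s \bigcup_i string_events (Xi i) >>.

(* [Xi i w m] is the letter at position [m] of the string numbered [i]; both
   indices start at 0. *)
Record poisson_string_model (Xi : nat -> Omega -> nat -> A)
    (N : R -> {RV P >-> nat}) : Prop := {
  letter_measurable : forall i m, letter_events (Xi i) m `<=` measurable ;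
  letter_uniform : forall i m a,
    P [set w | Xi i w m = a] = (#|A|%:R^-1)%:E ;
  letters_independent : forall i, independent_systems (letter_events (Xi i)) ;
  strings_independent : independent_systems (fun i => string_events (Xi i)) ;
  size_poisson : forall l, 0 < l -> forall n,
    P [set w | N l w = n] = (poisson_pmf l n)%:E ;
  size_independent : forall l, 0 < l -> forall (B : set nat) (E : set Omega),
    family_events Xi E ->
    P (N l @^-1` B `&` E) = (P (N l @^-1` B) * P E)%E }.

Context (Xi : nat -> Omega -> nat -> A) (N : R -> {RV P >-> nat}).

Definition sample (l : R) (w : Omega) (i : 'I_(N l w)) : nat -> A := Xi i w.

Definition f_prot (k : nat) (l : R) : R :=
  fine (P [set w : Omega | trie (@sample l w) !=set0 /\ protected (@sample l w) k [::]]).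

(* The real-valued integral is 0 if the integral is infinite, so an equivalence
   [f_prot_star ~ b] with [b] eventually nonzero entails finiteness. *)
Definition f_prot_star (k : nat) : R :=
  \int[lebesgue_measure]_(l in `]0, +oo[) (f_prot k l * l ^- 2).

End Model.

Arguments f_prot {R d Omega} P {A} Xi N k l.
Arguments f_prot_star {R d Omega} P {A} Xi N k.

Definition asymp_equiv (R : realType) (a b : nat -> R) : Prop :=
  a j / b j @[j --> \oo] --> (1 : R).

(* Main.v *)
(* Write [m = r ^ (k - 1)]. Up to the null event that some strings coincide, the
   root is [k]-protected iff there is at least one string and no prefix of length
   [k - 1] is carried by exactly one string. The [m] prefix counts are
   independent Poisson variables of mean [l / m], so that
   [f_prot k l = (1 - (l/m) e^(-l/m))^m - e^(-l)]. This is obtained here without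
   Poisson thinning: inclusion-exclusion counts the words of length [n] over [m]
   letters with no letter occurring once, and the resulting finite sum of
   exponential series is [(e^z - z)^m], with [z = l/m].

   For the integral put [x = l/m], [a = 1 - x e^(-x)], [b = e^(-x)]. Then
   [x^2/2 - x^3/3 <= a - b <= x^2/2] and [a^m - b^m] lies between
   [m (a - b) b^(m-1)] and [m (a - b) a^(m-1)], so [m f_prot l^(-2)] is close to
   [e^(-l) / 2] for [x] small. The part [x >= L] contributes at most [1/L], and
   for [x] between two constants [a^m] is [O(1/m)]. Hence
   [m f_prot_star -> 1/2]. *)
Require Import Defs.
From HB Require Import structures.
From mathcomp Require Import all_boot all_order all_algebra.
From mathcomp Require Import lra ring zify.

Set Implicit Arguments.
Unset Strict Implicit.
Unset Printing Implicit Defensive.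

(** * Words in which no letter occurs exactly once *)

(* Placed before the import of [all_classical], whose set operations shadow
   those of [finset]. *)
Section SingletonCount.
Context (T : finType).

(* Inclusion-exclusion only uses [K = set0]; a general [K] is what makes the
   recursion on [n] close up. *)
Definition hits (n : nat) (J K : {set T}) : nat :=
  #|[set s : n.-tuple T | [forall t, ((t \in J) ==> (count_mem t s == 1%N))
                                  && ((t \in K) ==> (count_mem t s == 0%N))]]|.

Lemma card_tuple_recl n (p : pred (seq T)) :
  #|[set s : n.+1.-tuple T | p s]| =
  (\sum_(x : T) #|[set s : n.-tuple T | p (x :: s)]|)%N.
Proof.
rewrite -sum1dep_card.
rewrite (reindex (fun u : T * n.-tuple T => [tuple of u.1 :: u.2])).
  rewrite /= -(pair_big_dep xpredT (fun x (s : n.-tuple T) => p (x :: s))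
    (fun _ _ => 1%N))/=.
  by apply: eq_bigr => x _; rewrite sum1dep_card.
exists (fun s : n.+1.-tuple T => (thead s, [tuple of behead s])) => [[x s] _|s _].
  by congr pair; apply: val_inj.
by rewrite /= [in RHS](tuple_eta s).
Qed.

(** Split on the first letter. Outside [J] and [K] it changes no constraint; in [K] it is forbidden;
    in [J] it is the one allowed occurrence, so it moves from [J] to [K]. *)
Lemma hitsS n (J K : {set T}) : [disjoint J & K] ->
  hits n.+1 J K = (#|~: (J :|: K)| * hits n J K +
                   \sum_(x in J) hits n (J :\ x) (x |: K))%N.
Proof.
move=> dJK; rewrite /hits.
rewrite (card_tuple_recl n (fun s =>
  [forall t, ((t \in J) ==> (count_mem t s == 1%N))
             && ((t \in K) ==> (count_mem t s == 0%N))])).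
rewrite (bigID (mem J))/= addnC; congr addn.
  rewrite (bigID (mem K))/= big1 ?add0n => [|x /andP[xJ xK]]; last first.
    apply/eqP; rewrite cards_eq0; apply/eqP/setP => s; rewrite !inE.
    apply/negP => /forallP/(_ x)/andP[_ /implyP/(_ xK)].
    by rewrite /= eqxx.
  rewrite -sum_nat_const; apply: eq_big => [x|x /andP[xJ xK]].
    by rewrite !inE negb_or.
  apply: eq_card => s; rewrite !inE; apply: eq_forallb => t /=.
  have [xt|_] := eqVneq x t; last by rewrite add0n.
  by rewrite -xt (negbTE xJ) (negbTE xK).
apply: eq_bigr => x xJ; apply: eq_card => s; rewrite !inE.
apply: eq_forallb => t /=; rewrite !inE [t == x]eq_sym.
have [xt|_] := eqVneq x t; last by rewrite add0n.
rewrite -xt xJ/= eqSS.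
by rewrite (disjointFr dJK xJ) !andbT.
Qed.

(** Place the letters of [J] at distinct positions and fill the others freely from outside
    [J :|: K]. If [n < #|J|] the falling factorial vanishes, so the truncated exponent is
    harmless. *)
Lemma hitsE n (J K : {set T}) : [disjoint J & K] ->
  hits n J K = (n ^_ #|J| * #|~: (J :|: K)| ^ (n - #|J|))%N.
Proof.
elim: n J K => [|n IH] J K dJK.
  rewrite /hits sub0n expn0 muln1 ffact0n cards_eq0.
  have [->|/set0Pn[x xJ]] := eqVneq J set0.
    rewrite (_ : [set s | _] = setT) ?cardsT ?card_tuple//.
    apply/setP => s; rewrite !inE tuple0/=; apply/forallP => t.
    by rewrite inE implybT.
  apply/eqP; rewrite cards_eq0; apply/eqP/setP => s; rewrite !inE.
  by apply/negP => /forallP/(_ x)/andP[/implyP/(_ xJ)]; rewrite tuple0.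
rewrite hitsS// IH//.
have [->|J0] := eqVneq J set0.
  by rewrite big_set0 addn0 cards0 !ffactn0 !subn0 !mul1n expnS.
rewrite (eq_bigr (fun=> n ^_ #|J|.-1 * #|~: (J :|: K)| ^ (n - #|J|.-1)))%N.
  rewrite sum_nat_const.
  have J1 : (0 < #|J|)%N by rewrite card_gt0.
  rewrite -(prednK J1); set j := #|J|.-1; set c := #|_|.
  rewrite ffactSS subSS [(n ^_ _.+1)%N]ffactnSr.
  (* For [j < n] one factor [c] is split off [c ^ (n - j)]. For [n <= j] that exponent is 0: the two
     sides agree if [n = j] and vanish if [n < j]. *)
  have [jn|nj] := ltnP j n.
    rewrite -[(n - j)%N in LHS]prednK ?subn_gt0// -subnS.
    have -> : (n - j = (n - j.+1).+1)%N by lia.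
    rewrite expnS /=; move: (n ^_ j)%N (c ^ (n - j.+1))%N => a e.
    have -> : n.+1 = (j.+1 + (n - j.+1).+1)%N by lia.
    by ring.
  have -> : (n - j = 0)%N by lia.
  rewrite expn0 !muln1 muln0 mul0n muln0 add0n /=.
  have [->//|nj'] := eqVneq n j.
  by rewrite ffact_small ?muln0//; lia.
move=> x xJ; rewrite IH; last first.
  apply/pred0P => t; rewrite !inE; case: eqVneq => //= _.
  by case tJ: (t \in J) => //=; exact: disjointFr dJK tJ.
have -> : J :\ x :|: (x |: K) = J :|: K.
  by rewrite setUA [_ :|: [set x]]setUC setD1K.
by rewrite [#|J|](cardsD1 x) xJ.
Qed.

Import GRing.Theory.
Local Open Scope ring_scope.

Definition singleton_free (s : seq T) : bool :=
  [forall t, count_mem t s != 1%N].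

Lemma sum_setX (R : comNzRingType) (a b : R) :
  \sum_(J : {set T}) a ^+ #|J| * b ^+ (#|T| - #|J|) = (a + b) ^+ #|T|.
Proof.
rewrite -[in RHS]prodr_const bigA_distr; apply: eq_bigr => J _.
rewrite (bigID (mem J))/= -prodr_const; congr (_ * _).
  by apply: eq_bigr => t ->.
have -> : (#|T| - #|J| = #|~: J|)%N by rewrite [#|~: J|]cardsCs setCK.
rewrite -prodr_const; apply: eq_big => [t|t]; first by rewrite inE.
by rewrite inE => /negbTE ->.
Qed.

(** Inclusion-exclusion: expand the product over [t] of [1 - single s t], which is the indicator of
    a singleton-free word. For fixed [J], summing over the words gives [hits n J set0] up to
    sign. *)
Lemma card_singleton_free (R : comNzRingType) n :
  #|[set s : n.-tuple T | singleton_free s]|%:R =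
  \sum_(J : {set T}) (-1) ^+ #|J| *
     (n ^_ #|J| * (#|T| - #|J|) ^ (n - #|J|))%:R :> R.
Proof.
pose single (s : seq T) t : R := (count_mem t s == 1%N)%:R.
have cardE (p : pred (n.-tuple T)) :
    #|[set s | p s]|%:R = \sum_s (p s)%:R :> R.
  rewrite -sum1dep_card natr_sum [LHS]big_mkcond/=.
  by apply: eq_bigr => s _; case: (p s).
have -> : #|[set s : n.-tuple T | singleton_free s]|%:R =
    \sum_(s : n.-tuple T) \prod_t (- single s t + 1).
  rewrite cardE; apply: eq_bigr => s _.
  rewrite /single; have [/forallP h|/forallPn[t]] := boolP (singleton_free s).
    by rewrite big1// => t _; rewrite (negbTE (h t)) oppr0 add0r.
  by rewrite negbK => /eqP h; rewrite (bigD1 t)//= h eqxx addNr mul0r.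
under eq_bigr do rewrite bigA_distr.
rewrite exchange_big; apply: eq_bigr => J _ /=.
have -> : (n ^_ #|J| * (#|T| - #|J|) ^ (n - #|J|))%N = hits n J set0.
  rewrite hitsE ?setU0; last by rewrite -setI_eq0 setI0.
  by rewrite [#|~: J|]cardsCs setCK.
rewrite /hits cardE mulr_sumr; apply: eq_bigr => s _.
rewrite (bigID (mem J))/= [X in _ * X]big1 ?mulr1; last first.
  by move=> t /negbTE ->.
have -> : \prod_(t in J) (if t \in J then - single s t else 1) =
   \prod_(t in J) (-1 * single s t).
  by apply: eq_bigr => t ->; rewrite mulN1r.
rewrite big_split/= prodr_const; congr (_ * _).
set B := [forall t, _]; have [/forallP h|/forallPn[t]] := boolP B.
  rewrite big1// => t tJ; have /andP[/implyP/(_ tJ) ht _] := h t.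
  by rewrite /single ht.
rewrite in_set0 implyFb andbT negb_imply => /andP[tJ ht].
by rewrite (bigD1 t)//= /single (negbTE ht) mul0r.
Qed.

End SingletonCount.

From mathcomp Require Import all_classical all_reals all_analysis.
From mathcomp Require Import measurable_realfun.

Import Order.TTheory GRing.Theory Num.Theory.
Import numFieldNormedType.Exports.

Local Open Scope classical_set_scope.
Local Open Scope ring_scope.

(** * Bounds on the protection probability *)

Section ElementaryBounds.
Context (R : realType).
Implicit Types (x y : R) (m : nat).

Lemma ge0_of_derive (h dh : R -> R) :
  (forall x, is_derive x 1 h (dh x)) -> h 0 = 0 ->
  (forall x, 0 <= x -> 0 <= dh x) -> forall x, 0 <= x -> 0 <= h x.
Proof.
move=> hd h0 dh0 x x0.
have hc : {within `[0, x], continuous h}.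
  by apply: derivable_within_continuous => z _; exact: ex_derive.
have [c] := MVT_segment x0 (fun z _ => hd z) hc.
rewrite h0 !subr0 in_itv/= => /andP[c0 _] ->.
by rewrite mulr_ge0 ?dh0.
Qed.

(** This is [a - b <= x^2/2] for [a = 1 - x e^(-x)] and [b = e^(-x)]. The difference of the two
    sides vanishes at 0 and has derivative [x (1 - e^(-x))]. *)
Lemma expRN_ge_quad x : 0 <= x -> 1 - x ^+ 2 / 2 <= (1 + x) * expR (- x).
Proof.
move=> x0; rewrite -subr_ge0.
pose h (z : R) := (1 + z) * expR (- z) - (1 - z ^+ 2 / 2).
apply: (@ge0_of_derive h (fun z => z * (1 - expR (- z)))) => //.
- move=> z; rewrite /h; apply: is_derive_eq.
  by rewrite /GRing.scale/=; field.
- by rewrite /h oppr0 expR0 expr0n/= mul0r subr0 addr0 mulr1 subrr.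
- move=> z z0; rewrite mulr_ge0// subr_ge0 -expR0 ler_expR; lra.
Qed.

Lemma expRN_le_cubic x : 0 <= x ->
  (1 + x) * expR (- x) <= 1 - x ^+ 2 / 2 + x ^+ 3 / 3.
Proof.
move=> x0; rewrite -subr_ge0.
pose h (z : R) := (1 - z ^+ 2 / 2 + z ^+ 3 / 3) - (1 + z) * expR (- z).
apply: (@ge0_of_derive h (fun z => z * (expR (- z) - (1 - z)))) => //.
- move=> z; rewrite /h; apply: is_derive_eq.
  by rewrite /GRing.scale/=; field.
- by rewrite /h oppr0 expR0 !expr0n/= !mul0r subr0 !addr0 mulr1 subrr.
- move=> z z0; rewrite mulr_ge0// subr_ge0; exact: expR_ge1Dx.
Qed.

Lemma xexpN_le1 x : x * expR (- x) <= 1.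
Proof.
by have := expR_ge1Dx x; rewrite expRN ler_pdivrMr ?expR_gt0// mul1r; lra.
Qed.

Lemma expRN_le_1BxexpN x : expR (- x) <= 1 - x * expR (- x).
Proof.
rewrite -subr_ge0 expRN.
have e0 := expR_gt0 x.
rewrite (_ : _ - _ = (expR x - (1 + x)) / expR x); last by field; lra.
by rewrite divr_ge0 ?(ltW e0)// subr_ge0 expR_ge1Dx.
Qed.

Lemma expRN_mul m y : (0 < m)%N -> expR (- (y / m%:R)) ^+ m = expR (- y).
Proof.
move=> m0; rewrite -expRM_natl mulrN mulrCA divff ?mulr1//.
by rewrite pnatr_eq0 -lt0n.
Qed.

(** [a^m - b^m] is [a - b] times a sum of [m] monomials of degree [m - 1] in [a] and [b], each
    between [b^(m-1)] and [a^(m-1)]. *)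
Lemma subrX_bounds m (a b : R) : 0 <= b -> b <= a ->
  m%:R * (a - b) * b ^+ m.-1 <= a ^+ m - b ^+ m <= m%:R * (a - b) * a ^+ m.-1.
Proof.
move=> b0 ba; case: m => [|m]/=; first by rewrite !mul0r !expr0 subrr lexx.
have a0 : 0 <= a by exact: le_trans ba.
have const_sum c : m.+1%:R * (a - b) * c = (a - b) * \sum_(i < m.+1) c.
  by rewrite sumr_const card_ord -mulr_natl; ring.
have le_m (i : 'I_m.+1) : (i <= m)%N by rewrite -ltnS.
rewrite subrXX !const_sum !ler_wpM2l ?subr_ge0//=.
  apply: ler_sum => i _; rewrite -[X in a ^+ X](subnK (le_m i)).
  by rewrite exprD ler_wpM2l ?exprn_ge0 ?lerXn2r ?nnegrE.
apply: ler_sum => i _; rewrite -[X in b ^+ X](subnK (le_m i)).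
by rewrite exprD ler_wpM2r ?exprn_ge0 ?lerXn2r ?nnegrE.
Qed.

(* [nsp m y] is the probability that [m] independent Poisson counts of mean
   [y / m] avoid the value [1] without all being zero. *)
Definition nsp m y : R :=
  (1 - y / m%:R * expR (- (y / m%:R))) ^+ m - expR (- y).

Lemma nsp_ge0 m y : (0 < m)%N -> 0 <= nsp m y.
Proof.
move=> m0; rewrite /nsp -(expRN_mul y m0) subr_ge0.
have h := expRN_le_1BxexpN (y / m%:R).
by rewrite lerXn2r ?nnegrE ?expR_ge0//; apply: le_trans h; exact: expR_ge0.
Qed.

Lemma nsp_le1 m y : (0 < m)%N -> 0 <= y -> nsp m y <= 1.
Proof.
move=> m0 y0; rewrite /nsp lerBlDr; apply: (@le_trans _ _ 1); last first.
  by rewrite lerDl expR_ge0.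
rewrite exprn_ile1 ?subr_ge0 ?xexpN_le1//.
by rewrite gerBl mulr_ge0 ?expR_ge0 ?divr_ge0.
Qed.

(* [y e^(-y/2) <= 2] turns the cubic error into an exponential, so that only
   nonnegative functions have to be integrated. *)
Lemma nsp_lower m y : (0 < m)%N -> 0 < y ->
  2^-1 * expR (- y) <=
    m%:R * (nsp m y * y ^- 2) + (2 / (3 * m%:R)) * expR (- (2^-1 * y)).
Proof.
move=> m0 y0; set x := y / m%:R.
have M0 : (0 : R) < m%:R by rewrite ltr0n.
have yE : y = m%:R * x by rewrite /x; field; lra.
have x0 : 0 < x by rewrite divr_gt0.
have h3 := expRN_le_cubic (ltW x0).
have hb0 := expR_gt0 (- x).
have hab := expRN_le_1BxexpN x.
have /andP[+ _] := subrX_bounds m (ltW hb0) hab.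
rewrite (expRN_mul y m0) -/(nsp m y) => hn.
have hb : expR (- y) <= expR (- x) ^+ m.-1.
  rewrite -(expRN_mul y m0) -/x -{1}(prednK m0) exprS ger_pMl ?exprn_gt0//.
  by rewrite -expR0 ler_expR; lra.
(* Dividing the lower bound of [subrX_bounds] by [m x^2 = y^2 / m] turns [a - b >= x^2/2 - x^3/3]
   into the factor [1/2 - x/3]; the part [x/3] is the error estimated in [h2]. *)
have h1 : (2^-1 - x / 3) * expR (- y) <= m%:R * (nsp m y * y ^- 2).
  have -> : m%:R * (nsp m y * y ^- 2) = nsp m y / (m%:R * x ^+ 2).
    by rewrite yE; field; lra.
  have mx : 0 < m%:R * x ^+ 2 by rewrite mulr_gt0// exprn_gt0.
  rewrite ler_pdivlMr//; apply: le_trans hn.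
  set b := expR (- x) in h3 hb0 hab hb *.
  have -> : (2^-1 - x / 3) * expR (- y) * (m%:R * x ^+ 2) =
     m%:R * (x ^+ 2 / 2 - x ^+ 3 / 3) * expR (- y) by field.
  have ab0 : 0 <= 1 - x * b - b by lra.
  apply: (@le_trans _ _ (m%:R * (1 - x * b - b) * expR (- y))).
    rewrite ler_wpM2r ?expR_ge0// ler_wpM2l ?(ltW M0)//; lra.
  by rewrite ler_wpM2l// mulr_ge0 ?(ltW M0).
have h2 : x / 3 * expR (- y) <= (2 / (3 * m%:R)) * expR (- (2^-1 * y)).
  have -> : expR (- y) = expR (- (2^-1 * y)) * expR (- (2^-1 * y)).
    by rewrite -expRD; congr expR; field.
  have h := xexpN_le1 (2^-1 * y).
  rewrite mulrA ler_wpM2r ?expR_ge0//.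
  have -> : x / 3 * expR (- (2^-1 * y)) =
    2 / (3 * m%:R) * (2^-1 * y * expR (- (2^-1 * y))) by rewrite /x; field; lra.
  by rewrite ler_piMr// divr_ge0// mulr_ge0// ltW.
by rewrite mulrBl in h1; lra.
Qed.

(* One term for each of the ranges [y < dl m], [dl m <= y < L m], [L m <= y]. *)
Lemma nsp_upper m (dl L y : R) : (1 < m)%N -> 0 < dl -> dl <= L -> 0 < y ->
  m%:R * (nsp m y * y ^- 2) <=
    2^-1 * expR (- (m.-1%:R / m%:R * expR (- dl) * y)) +
    (expR L / dl * (y ^- 2 * \1_`[dl * m%:R, +oo[ y) +
     m%:R * (y ^- 2 * \1_`[L * m%:R, +oo[ y)).
Proof.
move=> m1 dl0 dlL y0; rewrite !indicE !mem_setE !in_itv/= !andbT.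
set x := y / m%:R.
have m0 : (0 < m)%N by exact: ltnW.
have M0 : (0 : R) < m%:R by rewrite ltr0n.
have yE : y = m%:R * x by rewrite /x; field; lra.
have x0 : 0 < x by rewrite divr_gt0.
have y2 : 0 <= y ^- 2 by rewrite invr_ge0 exprn_ge0 ?ltW.
have t1 : 0 <= 2^-1 * expR (- (m.-1%:R / m%:R * expR (- dl) * y)).
  by rewrite mulr_ge0 ?expR_ge0.
have eL : 0 <= expR L / dl by rewrite divr_ge0 ?expR_ge0 ?ltW.
have t2 : 0 <= expR L / dl * (y ^- 2 * (dl * m%:R <= y)%R%:R).
  by rewrite mulr_ge0// mulr_ge0.
have t3 : 0 <= m%:R * (y ^- 2 * (L * m%:R <= y)%R%:R).
  by rewrite mulr_ge0 ?(ltW M0)// mulr_ge0.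
have hb0 := expR_gt0 (- x).
have hab := expRN_le_1BxexpN x.
have a0 : 0 <= 1 - x * expR (- x) by rewrite subr_ge0 xexpN_le1.
(* From [1 - t <= e^(-t)] at [t = x e^(-x)]. *)
have aX k : (1 - x * expR (- x)) ^+ k <= expR (- (k%:R * (x * expR (- x)))).
  rewrite -(mulrN k%:R) expRM_natl lerXn2r ?nnegrE ?expR_ge0//.
  exact: (expR_ge1Dx (- (x * expR (- x)))).
have [Ly|Ly] := leP (L * m%:R) y.
  apply: (@le_trans _ _ (m%:R * (y ^- 2 * true%:R))); last by lra.
  rewrite mulr1 ler_wpM2l ?(ltW M0)// ler_piMl// nsp_le1//; exact: ltW.
(* In the middle range, [t e^(-t) <= 1] at [t = m x e^(-x)] bounds [m a^m] by [e^x / x], hence by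
   [e^L / dl]. *)
have [dy|dy] := leP (dl * m%:R) y.
  apply: (@le_trans _ _ (expR L / dl * (y ^- 2 * true%:R))); last first.
    by rewrite mulr1n mulr0n !mulr0 addr0 lerDr.
  rewrite mulr1n mulr1 mulrA ler_wpM2r//.
  have dx : dl <= x by rewrite /x ler_pdivlMr.
  have xL : x <= L by rewrite /x ler_pdivrMr// ltW.
  have h : nsp m y <= expR (- (m%:R * (x * expR (- x)))).
    by apply: le_trans (aX m); rewrite /nsp gerBl expR_ge0.
  apply: (@le_trans _ _ (m%:R * expR (- (m%:R * (x * expR (- x)))))).
    by rewrite ler_wpM2l ?(ltW M0).
  have h1 := xexpN_le1 (m%:R * (x * expR (- x))).
  have xe : 0 < x * expR (- x) by rewrite mulr_gt0.
  apply: (@le_trans _ _ (x * expR (- x))^-1).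
    by rewrite -[leRHS]mul1r ler_pdivlMr// mulrAC.
  rewrite invfM -expRN opprK mulrC ler_pM ?expR_ge0 ?invr_ge0 ?(ltW x0)//.
    by rewrite ler_expR.
  by rewrite lef_pV2// posrE.
rewrite mulr0n !mulr0 !addr0.
have xd : x < dl by rewrite /x ltr_pdivrMr.
have /andP[_] := subrX_bounds m (ltW hb0) hab.
rewrite (expRN_mul y m0) -/(nsp m y) => hn.
have h2 := expRN_ge_quad (ltW x0).
have -> : m%:R * (nsp m y * y ^- 2) = nsp m y / (m%:R * x ^+ 2).
  by rewrite yE; field; lra.
have mx : 0 < m%:R * x ^+ 2 by rewrite mulr_gt0// exprn_gt0.
rewrite ler_pdivrMr//; apply: (le_trans hn).
rewrite (mulrAC _ (expR _)) ler_pM ?exprn_ge0//.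
- by rewrite mulr_ge0 ?(ltW M0)//; lra.
- by rewrite mulrCA ler_wpM2l ?(ltW M0)//; lra.
(* As [x < dl], the exponent [(m-1) x e^(-x)] is at least [(m-1)/m e^(-dl) y], which is linear in
   [y]. *)
- apply: le_trans (aX m.-1) _.
  rewrite ler_expR lerN2 mulrAC -!mulrA ler_wpM2l// -/x.
  rewrite mulrCA mulrC [leRHS]mulrC.
  by rewrite ler_wpM2r ?(ltW y0)// ler_wpM2l ?invr_ge0// ler_expR lerN2 ltW.
Qed.
End ElementaryBounds.

(** * Poisson mixtures of the counts *)

Section SingletonSeries.
Context (R : realType).

(** The terms with [n < j] vanish. Beyond them [n ^_ j / n! = 1 / (n - j)!], so shifting by [j]
    leaves the exponential series of [c z]. *)
Lemma cvg_series_ffact (z : R) (j c : nat) :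
  series (fun n => n`!%:R^-1 * z ^+ n * (n ^_ j * c ^ (n - j))%:R) @ \oo
    --> z ^+ j * expR (c%:R * z).
Proof.
set u := fun n : nat => _.
rewrite -(cvg_shiftn j).
rewrite (_ : (fun n => _) = fun n => z ^+ j * series (exp_coeff (c%:R * z)) n).
  apply: cvgMr; rewrite /expR; exact: is_cvg_series_exp_coeff.
apply/funext => n; rewrite /series/= (@big_cat_nat _ _ _ j)//=; last exact: leq_addl.
rewrite big_nat big1 ?add0r => [|k /andP[_ kj]]; last first.
  by rewrite /u ffact_small// mul0n mulr0.
rewrite -{1}(add0n j) big_addn addnK mulr_sumr; apply: eq_bigr => k _.
rewrite /u exp_coeffE /= addnK natrM natrX.
have h : (k + j)`!%:R = ((k + j) ^_ j)%:R * k`!%:R :> R.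
  by rewrite -natrM -[in LHS](@ffact_fact (k + j) j) ?leq_addl// addnK.
rewrite h exprD exprMn; field.
by rewrite !pnatr_eq0 -!lt0n fact_gt0 ffact_gt0 leq_addl.
Qed.

(** By [card_singleton_free] this is a finite signed sum of the preceding series. Their signed
    limits [(-z)^j (e^z)^(#|T| - j)], with [j = #|J|], add up by the subset form of the binomial
    theorem. *)
Lemma cvg_series_singleton_free (T : finType) (z : R) :
  series (fun n => n`!%:R^-1 * z ^+ n *
    #|finset (fun s : n.-tuple T => singleton_free s)|%:R) @ \oo
    --> (expR z - z) ^+ #|T|.
Proof.
pose v (J : {set T}) n : R :=
  n`!%:R^-1 * z ^+ n * (n ^_ #|J| * (#|T| - #|J|) ^ (n - #|J|))%:R.
rewrite (_ : series _ =
    fun n => \sum_(J : {set T}) (-1) ^+ #|J| * series (v J) n).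
  rewrite (_ : _ ^+ _ = \sum_(J : {set T})
     (-1) ^+ #|J| * (z ^+ #|J| * expR ((#|T| - #|J|)%:R * z))).
    apply: cvg_big => [|J _]; first exact: add_continuous.
    by apply: cvgMr; exact: cvg_series_ffact.
  rewrite addrC -sum_setX; apply: eq_bigr => J _.
  by rewrite (exprNn z) expRM_natl mulrA.
apply/funext => n; rewrite /series/=.
under [RHS]eq_bigr do rewrite mulr_sumr.
rewrite exchange_big/=; apply: eq_bigr => k _.
rewrite card_singleton_free mulr_sumr; apply: eq_bigr => J _.
by rewrite /v; ring.
Qed.

(** The [n]-th term is the probability that there are [n] strings and that, falling uniformly into
    [#|T|] cells, they leave no cell with exactly one. Distributing [e^(-l) = (e^(-z))^m] over the
    power gives the closed form. *)
Lemma cvg_series_poisson_singleton_free (T : finType) (l : R) :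
  (0 < #|T|)%N -> 0 < l ->
  series (fun n => poisson_pmf l n *
    (#|finset (fun s : n.-tuple T => singleton_free s)|%:R / #|T|%:R ^+ n)) @ \oo
    --> (1 - l / #|T|%:R * expR (- (l / #|T|%:R))) ^+ #|T|.
Proof.
move=> T0 l0; set m := #|T|; have M0 : (0 : R) < m%:R by rewrite ltr0n.
set z := l / m%:R.
rewrite (_ : series _ = fun n => expR (- l) *
    series (fun n => n`!%:R^-1 * z ^+ n *
      #|finset (fun s : n.-tuple T => singleton_free s)|%:R) n); last first.
  apply/funext => n; rewrite /series/= mulr_sumr; apply: eq_bigr => k _.
  rewrite /poisson_pmf l0 /z expr_div_n; field.
  by rewrite lt0r_neq0 ?exprn_gt0// lt0r_neq0// ltr0n fact_gt0.
rewrite (_ : _ ^+ _ = expR (- l) * (expR z - z) ^+ m).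
  by apply: cvgMr; exact: cvg_series_singleton_free.
rewrite -(expRN_mul l T0) -/m -/z -exprMn; congr (_ ^+ _).
by rewrite mulrBr -expRD addNr expR0; ring.
Qed.
End SingletonSeries.

(** * Asymptotics of the integral *)

Section Integrals.
Context (R : realType).
Local Notation mu := (@lebesgue_measure R).
Local Notation D := (`]0%R, +oo[%classic : set R).
Implicit Types (y c a : R) (m : nat).

Lemma integral_expRN c : 0 < c ->
  (\int[mu]_(y in D) (expR (- (c * y)))%:E = (c^-1)%:E)%E.
Proof.
move=> c0.
have mE : measurable_fun [set: R] (EFin \o fun y => expR (- (c * y))).
  apply/measurable_EFinP/measurableT_comp => //.
  exact/measurableT_comp/measurable_funM.
have := integral_exponential_pdf c0.
rewrite -[X in integral _ _ X]/(EFin \o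
  ((fun y => c * expR (- c * y)) \_ `[0, +oo[)).
rewrite -restrict_EFin -integral_mkcond.
under eq_integral => y _ do rewrite /= mulNr EFinM.
rewrite ge0_integralZl_EFin//; [|exact: measurable_funTS|exact: ltW].
rewrite -integral_itv_obnd_cbnd; last exact: measurable_funTS.
move=> h; rewrite -[LHS]mul1e -[in LHS](mulVf (lt0r_neq0 c0)) EFinM -muleA h.
by rewrite mule1.
Qed.

Lemma integral_inv_sqr a : 0 < a ->
  (\int[mu]_(y in `[a, +oo[) (y ^- 2)%:E = (a^-1)%:E)%E.
Proof.
move=> a0.
have d (x : R) : 0 < x -> is_derive x 1 (fun y : R => - y^-1) (x ^- 2).
  move=> x0; have nx0 := lt0r_neq0 x0.
  have dV := is_deriveV nx0 (is_derive_id x 1).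
  by apply: is_derive_eq; rewrite /GRing.scale/= mulr1 opprK.
have cont (x : R) : 0 < x -> {for x, continuous (fun y : R => y ^- 2)}.
  move=> x0; apply: (@continuous_comp _ _ _ (fun y : R => y ^+ 2) GRing.inv).
    exact: exprn_continuous.
  by apply: inv_continuous; rewrite expf_neq0// lt0r_neq0.
rewrite (@ge0_continuous_FTC2y _ _ (fun y => - y^-1) _ 0)//.
- by rewrite sub0e EFinN oppeK.
- by move=> x ax; rewrite invr_ge0 exprn_ge0// (le_trans _ ax)// ltW.
- apply/continuous_within_itvcyP; split => [x|].
    by rewrite in_itv/= andbT => ax; apply: cont; exact: lt_trans ax.
  by apply: cvg_at_right_filter; exact: cont.
- rewrite -oppr0; apply: cvgN; apply/gtr0_cvgV0; last exact: cvg_id.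
  exact: nbhs_pinfty_gt.
- by move=> x ax; have := d x (lt_trans a0 ax) => ?; exact: ex_derive.
- apply: cvg_at_right_filter; apply: cvgN; apply: inv_continuous.
  by rewrite lt0r_neq0.
- move=> x; rewrite in_itv/= andbT => ax.
  by have := d x (lt_trans a0 ax) => ?; rewrite derive1E derive_val.
Qed.

(** The truncation sits in the integrand so that all the majorants of [nsp_upper] are integrated
    over the same domain. *)
Lemma integral_inv_sqr_indic a : 0 < a ->
  (\int[mu]_(y in D) (y ^- 2 * \1_`[a, +oo[ y)%:E = (a^-1)%:E)%E.
Proof.
move=> a0; rewrite -integral_inv_sqr//.
rewrite -[in RHS](@setIidr _ D `[a, +oo[) => [|y/=]; last first.
  by rewrite !in_itv/= !andbT; exact: lt_le_trans.
rewrite integral_mkcondr epatch_indic.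
by apply: eq_integral => y _; rewrite EFinM.
Qed.

Lemma measurable_inv_sqr : measurable_fun D (fun y : R => y ^- 2).
Proof.
apply: open_continuous_measurable_fun => // y.
rewrite inE/= in_itv/= andbT => y0.
apply: (@continuous_comp _ _ _ (fun y : R => y ^+ 2) GRing.inv).
  exact: exprn_continuous.
by apply: inv_continuous; rewrite expf_neq0// lt0r_neq0.
Qed.

Lemma measurable_nsp m : measurable_fun [set: R] (nsp m : R -> R).
Proof.
have mV : measurable_fun [set: R] (fun y : R => y / m%:R).
  exact: measurable_funM.
have mE (g : R -> R) : measurable_fun [set: R] g ->
    measurable_fun [set: R] (fun y => expR (- g y)).
  by move=> mg; apply: measurableT_comp => //; exact: measurableT_comp.
apply: measurable_funB; last exact: mE.
apply: measurable_funX; apply: measurable_funB => //.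
by apply: measurable_funM => //; exact: mE.
Qed.

(** Kept in the extended reals, where nonnegative integrals can be added and compared before
    finiteness is known; finiteness then follows from the upper bound. *)
Definition nsp_integral m : \bar R :=
  (\int[mu]_(y in D) (nsp m y * y ^- 2)%:E)%E.

Lemma measurable_nsp_inv_sqr m :
  measurable_fun D (fun y : R => (nsp m y * y ^- 2)%:E).
Proof.
apply/measurable_EFinP; apply: measurable_funM; last exact: measurable_inv_sqr.
by apply: measurable_funTS; exact: measurable_nsp.
Qed.

Lemma nsp_inv_sqr_ge0 m y : (0 < m)%N -> 0 <= nsp m y * y ^- 2.
Proof. by move=> m0; rewrite mulr_ge0 ?nsp_ge0// invr_ge0 sqr_ge0. Qed.

Lemma measurable_expRNM c (A : set R) :
  measurable_fun A (fun y : R => (expR (- (c * y)))%:E).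
Proof.
apply/measurable_funTS/measurable_EFinP/measurableT_comp => //.
exact/measurableT_comp/measurable_funM.
Qed.

Lemma nsp_integral_lower m : (0 < m)%N ->
  ((2^-1)%:E <= m%:R%:E * nsp_integral m + (4 / (3 * m%:R))%:E)%E.
Proof.
move=> m0; have M0 : (0 : R) < m%:R by rewrite ltr0n.
have k0 : (0 : R) <= 2 / (3 * m%:R) by rewrite divr_ge0// mulr_ge0// ltW.
have -> : (4 / (3 * m%:R))%:E =
    (\int[mu]_(y in D) ((2 / (3 * m%:R))%:E * (expR (- (2^-1 * y)))%:E))%E.
  rewrite ge0_integralZl_EFin//; last exact: measurable_expRNM.
  by rewrite integral_expRN// -EFinM; congr EFin; field; lra.
have -> : (2^-1)%:E =
    (\int[mu]_(y in D) ((2^-1)%:E * (expR (- (1 * y)))%:E))%E :> \bar R.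
  rewrite ge0_integralZl_EFin//; last exact: measurable_expRNM.
  by rewrite integral_expRN// -EFinM; congr EFin; field.
rewrite /nsp_integral -ge0_integralZl_EFin//; last 2 first.
- by move=> y _; rewrite lee_fin nsp_inv_sqr_ge0.
- exact: measurable_nsp_inv_sqr.
rewrite -ge0_integralD; last 5 first.
- by [].
- by move=> y _; rewrite -EFinM lee_fin mulr_ge0 ?nsp_inv_sqr_ge0.
- by apply: measurable_funeM; exact: measurable_nsp_inv_sqr.
- by move=> y _; rewrite -EFinM lee_fin mulr_ge0 ?expR_ge0.
- by apply: measurable_funeM; exact: measurable_expRNM.
apply: ge0_le_integral => //.
- by apply: measurable_funeM; exact: measurable_expRNM.
- apply: emeasurable_funD; apply: measurable_funeM.
    exact: measurable_nsp_inv_sqr.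
  exact: measurable_expRNM.
- move=> y /=; rewrite in_itv/= andbT => y0.
  by rewrite -!EFinM -EFinD lee_fin mul1r; exact: nsp_lower.
Qed.

(** Integrate [nsp_upper] term by term: [1 / (2 c)] with [c = (m-1)/m e^(-dl)], then [e^L / dl]
    times [1 / (dl m)], then [m] times [1 / (L m)]. *)
Lemma nsp_integral_upper m (dl L : R) : (1 < m)%N -> 0 < dl -> dl <= L ->
  (m%:R%:E * nsp_integral m <=
   (m%:R / m.-1%:R * expR dl / 2 + expR L / dl ^+ 2 / m%:R + L^-1)%:E)%E.
Proof.
move=> m1 dl0 dlL; have m0 : (0 < m)%N by exact: ltnW.
have M0 : (0 : R) < m%:R by rewrite ltr0n.
have M1 : (0 : R) < m.-1%:R by rewrite ltr0n -ltnS prednK.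
have L0 : 0 < L by exact: lt_le_trans dlL.
set c := m.-1%:R / m%:R * expR (- dl).
have c0 : 0 < c by rewrite mulr_gt0 ?expR_gt0// divr_gt0.
have eL : 0 <= expR L / dl by rewrite divr_ge0 ?expR_ge0// ltW.
have i0 (a y : R) : 0 <= y ^- 2 * \1_`[a, +oo[ y.
  by rewrite mulr_ge0// invr_ge0 sqr_ge0.
have mi (a : R) : measurable_fun D (fun y : R => (y ^- 2 * \1_`[a, +oo[ y)%:E).
  apply/measurable_EFinP; apply: measurable_funM; first exact: measurable_inv_sqr.
  exact: measurable_indic.
have iE (a k : R) : 0 < a -> 0 <= k ->
    (\int[mu]_(y in D) (k%:E * (y ^- 2 * \1_`[a, +oo[ y)%:E) = (k / a)%:E)%E.
  move=> a0 k0; rewrite ge0_integralZl_EFin//; last exact: mi.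
    by rewrite integral_inv_sqr_indic.
  by move=> y _; rewrite lee_fin.
rewrite /nsp_integral -ge0_integralZl_EFin//; last 2 first.
- by move=> y _; rewrite lee_fin nsp_inv_sqr_ge0.
- exact: measurable_nsp_inv_sqr.
have -> : (m%:R / m.-1%:R * expR dl / 2 + expR L / dl ^+ 2 / m%:R + L^-1)%:E =
  (\int[mu]_(y in D) ((2^-1)%:E * (expR (- (c * y)))%:E +
     ((expR L / dl)%:E * (y ^- 2 * \1_`[(dl * m%:R)%R, +oo[ y)%:E +
      m%:R%:E * (y ^- 2 * \1_`[(L * m%:R)%R, +oo[ y)%:E)))%E.
  rewrite ge0_integralD; last 5 first.
  - by [].
  - by move=> y _; rewrite -EFinM lee_fin mulr_ge0 ?expR_ge0.
  - by apply: measurable_funeM; exact: measurable_expRNM.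
  - by move=> y _; rewrite -!EFinM -EFinD lee_fin addr_ge0// mulr_ge0.
  - by apply: emeasurable_funD; apply: measurable_funeM; exact: mi.
  rewrite ge0_integralD; last 5 first.
  - by [].
  - by move=> y _; rewrite -EFinM lee_fin mulr_ge0.
  - by apply: measurable_funeM; exact: mi.
  - by move=> y _; rewrite -EFinM lee_fin mulr_ge0.
  - by apply: measurable_funeM; exact: mi.
  rewrite !iE ?mulr_gt0 ?(ltW M0)// ge0_integralZl_EFin//; last first.
    exact: measurable_expRNM.
  rewrite integral_expRN//.
  rewrite -!EFinM -!EFinD; congr EFin; rewrite /c expRN.
  have e0 := expR_gt0 dl; field.
  by rewrite !lt0r_neq0.
apply: ge0_le_integral => //.
- by move=> y _; rewrite -EFinM lee_fin mulr_ge0 ?nsp_inv_sqr_ge0.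
- by apply: measurable_funeM; exact: measurable_nsp_inv_sqr.
- apply: emeasurable_funD.
    by apply: measurable_funeM; exact: measurable_expRNM.
  by apply: emeasurable_funD; apply: measurable_funeM; exact: mi.
- move=> y /=; rewrite in_itv/= andbT => y0.
  by rewrite -!EFinM -!EFinD lee_fin; exact: nsp_upper.
Qed.
End Integrals.

(** * Passage to the limit in the integral bounds *)

Section Limit.
Context (R : realType).

Lemma nsp_integral_fin_num m : (1 < m)%N -> (nsp_integral R m) \is a fin_num.
Proof.
move=> m1; have m0 : (0 < m)%N by exact: ltnW.
have M0 : (0 : R) < m%:R by rewrite ltr0n.
rewrite ge0_fin_numE; last first.
  by apply: integral_ge0 => y _; rewrite lee_fin nsp_inv_sqr_ge0.
have := @nsp_integral_upper R m 1 1 m1 ltr01 (lexx 1).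
case: (nsp_integral R m) => [r|//|//]; first by rewrite ltry.
by rewrite gt0_muley.
Qed.

Lemma cvg_nsp_integral :
  m%:R * fine (nsp_integral R m) @[m --> \oo] --> (2^-1 : R).
Proof.
apply/cvgrPdist_le => eps eps0.
(* The upper bound will exceed [1/2] by at most [2e + e + e <= eps]; [e <= 1/4] absorbs the square
   in [(1 + e)^2 / 2]. *)
pose e := Num.min eps 1 / 4.
have e0 : 0 < e by rewrite divr_gt0// lt_min eps0 ltr01.
have e4 : e <= 4^-1 by rewrite /e ler_pdivrMr// mulVf// ge_min lexx orbT.
have eeps : 4 * e <= eps by rewrite /e mulrC divfK// ge_min lexx.
(* Now [e^dl = 1 + e], and [L] is at least both [1/e] and [dl]. They are fixed before [m], so the
   middle term [C / m] still tends to 0. *)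
pose dl := ln (1 + e).
have dl0 : 0 < dl by rewrite ln_gt0// ltrDl.
pose L := e^-1 + dl.
have dlL : dl <= L by rewrite lerDr invr_ge0 ltW.
have L0 : 0 < L by exact: lt_le_trans dlL.
pose C := expR L / dl ^+ 2.
have C0 : 0 <= C by rewrite divr_ge0 ?expR_ge0 ?sqr_ge0.
near=> m.
have m1 : (1 < m)%N by near: m; exact: nbhs_infty_gt.
have m0 : (0 < m)%N by exact: ltnW.
have M0 : (0 : R) < m%:R by rewrite ltr0n.
have M1 : (1 : R) < m%:R by rewrite ltr1n.
have M2 : (m.-1%:R : R) = m%:R - 1 by rewrite -subn1 natrB.
(* Thresholds for, in this order, [m / (m-1) <= 1 + e], [C / m <= e] and [4 / (3 m) <= e]. *)
have he : 1 + e^-1 <= m%:R by near: m; exact: nbhs_infty_ger.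
have hC : C / e <= m%:R by near: m; exact: nbhs_infty_ger.
have h2 : 2 / e <= m%:R by near: m; exact: nbhs_infty_ger.
have Ifin := nsp_integral_fin_num m1.
have := nsp_integral_lower R m0; have := nsp_integral_upper m1 dl0 dlL.
rewrite -(fineK Ifin); set x := fine _.
rewrite -EFinM -EFinD !lee_fin -/C => hu hl.
have t1 : 4 / (3 * m%:R) <= e.
  rewrite ler_pdivrMr ?mulr_gt0//; move: h2; rewrite ler_pdivrMr//; lra.
have t2 : m%:R / m.-1%:R * expR dl / 2 <= 2^-1 + 2 * e.
  rewrite /dl lnK ?posrE ?addr_gt0// M2.
  have : m%:R / (m%:R - 1) <= 1 + e.
    rewrite ler_pdivrMr ?subr_gt0//.
    have : 1 <= (m%:R - 1) * e by rewrite -ler_pdivrMr// mul1r lerBrDl.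
    lra.
  move=> q1; have e1 : 0 <= 1 + e by rewrite addr_ge0// ltW.
  have := ler_wpM2r e1 q1; have := ler_wpM2l (ltW e0) e4; lra.
have t3 : C / m%:R <= e by rewrite ler_pdivrMr// mulrC -ler_pdivrMr.
have t4 : L^-1 <= e.
  by rewrite -[leRHS]invrK lef_pV2 ?posrE ?invr_gt0// lerDl ltW.
by rewrite /= ler_norml; apply/andP; split; lra.
Unshelve. all: by end_near. Qed.

(** For fixed [y] this tends to 0 as [m] grows; it will show that a nonempty sample almost surely
    has a prefix carried by exactly one string. The factor [a^(m-1)] is dropped because [a <= 1]. *)
Lemma nsp_le_inv m (y : R) : (0 < m)%N -> 0 <= y ->
  nsp m y <= y ^+ 2 / 2 / m%:R.
Proof.
move=> m0 y0; set x := y / m%:R.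
have M0 : (0 : R) < m%:R by rewrite ltr0n.
have x0 : 0 <= x by rewrite divr_ge0 ?(ltW M0).
have hb0 := expR_gt0 (- x).
have hab := expRN_le_1BxexpN x.
have h1 := xexpN_le1 x.
have /andP[_] := subrX_bounds m (ltW hb0) hab.
rewrite (expRN_mul y m0) -/(nsp m y) => hn; apply: le_trans hn _.
have -> : y ^+ 2 / 2 / m%:R = m%:R * (x ^+ 2 / 2).
  by rewrite /x; field; lra.
have h2 := expRN_ge_quad x0.
rewrite -mulrA ler_wpM2l ?(ltW M0)//.
apply: (@le_trans _ _ (1 - x * expR (- x) - expR (- x))); last by lra.
rewrite ler_piMr//; first by lra.
rewrite exprn_ile1 ?subr_ge0// gerBl mulr_ge0// ltW.
Qed.
End Limit.

(** * Protection of the root in terms of prefix counts *)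

Section TrieRoot.
Context (A : finType) (n : nat) (x : 'I_n -> nat -> A).
Implicit Types (v : seq A) (K k : nat).

Lemma has_prefix_take v j (s : nat -> A) :
  has_prefix v s -> has_prefix (take j v) s.
Proof.
rewrite /has_prefix => /eqP h; rewrite {1}h size_take.
rewrite -[X in _ == X]/(map s (iota 0 _)) -map_take take_iota.
by rewrite /minn; case: ltnP.
Qed.

Lemma nu_take v j : (nu x v <= nu x (take j v))%N.
Proof.
apply: subset_leq_card; apply/fintype.subsetP => i; rewrite !inE.
exact: has_prefix_take.
Qed.

(** Take the shortest prefix of [v] with count 1. If it is not the root, its parent has count at
    least 1, and not 1 by minimality, so the parent is internal. *)
Lemma external_take v : nu x v = 1%N ->
  exists2 j, (j <= size v)%N & external_node x (take j v).
Proof.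
move=> nu1.
have ex : exists j, nu x (take j v) == 1%N.
  by exists (size v); rewrite take_size nu1.
have [j /eqP nuj jmin] := ex_minnP ex.
have jv : (j <= size v)%N by apply: jmin; rewrite take_size nu1.
exists j => //; rewrite /external_node nuj eqxx /=.
case: j nuj jmin jv => [|j] nuj jmin jv; first by rewrite take0.
apply/orP; right; rewrite /internal_node /parent size_takel//= take_takel//.
have := nu_take (take j.+1 v) j; rewrite nuj take_takel// => h.
rewrite ltn_neqAle h andbT eq_sym; apply/negP => /jmin.
by rewrite ltnn.
Qed.

(** Follow the only string through [v] down to depth [K]: counts do not increase along the way, and
    this string keeps them positive. *)
Lemma external_extend v K : external_node x v -> (size v <= K)%N ->
  exists2 v', size v' = K & nu x v' = 1%N.
Proof.
move=> /andP[/eqP nu1 _] vK.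
have /card_gt0P[i] : (0 < nu x v)%N by rewrite nu1.
rewrite inE => /eqP vi.
exists (mkseq (x i) K); first by rewrite size_mkseq.
apply/eqP; rewrite eqn_leq; apply/andP; split; last first.
  by apply/card_gt0P; exists i; rewrite inE /has_prefix size_mkseq.
have := nu_take (mkseq (x i) K) (size v).
by rewrite {2}/mkseq -map_take take_iota (minn_idPl vK) -/(mkseq _ _) -vi nu1.
Qed.

Definition no_singleton K := forall v, size v = K -> nu x v != 1%N.

Lemma no_singletonP K :
  no_singleton K <-> forall v, external_node x v -> (K < size v)%N.
Proof.
split=> [h v ev|h v vK].
  rewrite ltnNge; apply/negP => /(external_extend ev)[v' v'K nu1].
  by have := h v' v'K; rewrite nu1.
apply/eqP => /external_take[j jv /h].
by rewrite size_takel// ltnNge -vK jv.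
Qed.

(** Being [k]-protected means that every leaf is deeper than [k.-1], provided a leaf exists. The
    last condition supplies that leaf; it can fail only when strings coincide or there are none. *)
Lemma protected_rootP k : (0 < k)%N ->
  trie x !=set0 /\ protected x k [::] <->
  [/\ (0 < n)%N, no_singleton k.-1 & exists K, ~ no_singleton K].
Proof.
move=> k0; split.
- move=> [[v tv] [m [[u eu um] mmin] km]]; split.
  + rewrite lt0n; apply/eqP => n0.
    have /andP[/eqP nu1 _] := eu.
    have /card_gt0P[i _] : (0 < nu x u)%N by rewrite nu1.
    by have h := ltn_ord i; lia.
  + apply/no_singletonP => v' ev'; rewrite prednK//.
    by apply: leq_trans km _; apply: mmin; exists v'.
  + exists (size u) => /no_singletonP/(_ u eu); by rewrite ltnn.
- move=> [n0 nsk [K nsK]].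
  have [u eu] : exists u, external_node x u.
    apply: contra_notP nsK => hu; apply/no_singletonP => v ev.
    by exfalso; apply: hu; exists v.
  split; first by exists u; rewrite /trie/= eu orbT.
  have ex : exists m, `[< leaf_distances x [::] m >].
    by exists (size u); apply/asboolP; exists u.
  have [m /asboolP dm mmin] := ex_minnP ex.
  exists m; first by split=> // m' dm'; apply: mmin; exact/asboolP.
  have [u' eu' <-] := dm.
  by have /no_singletonP/(_ u' eu') := nsk; rewrite prednK.
Qed.

End TrieRoot.

(** * The law of the prefix counts *)

Lemma sigma_algebra_bigcap_seq (T : pointedType) (I : choiceType)
    (G : set_system T) (s : seq I) (B : I -> set T) :
  (forall i, i \in s -> <<s G >> (B i)) ->
  <<s G >> (\bigcap_(i in [set` s]) B i).
Proof.
move=> GB; rewrite bigcap_seq big_seq.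
exact: (@bigsetI_measurable _ (g_sigma_algebraType G)).
Qed.

Section PoissonTrie.
Context (R : realType) d (Omega : measurableType d) (P : probability Omega R).
Context (A : finType) (Xi : nat -> Omega -> nat -> A) (N : R -> {RV P >-> nat}).
Context (model : poisson_string_model Xi N) (A0 : (0 < #|A|)%N).
Implicit Types (i n K k : nat) (l : R).

Lemma string_events_measurable i : string_events (Xi i) `<=` measurable.
Proof.
apply: smallest_sub; first exact: sigma_algebra_measurable.
by move=> B [j _]; exact: (letter_measurable model).
Qed.

Lemma family_events_measurable : family_events Xi `<=` measurable.
Proof.
apply: smallest_sub; first exact: sigma_algebra_measurable.
by move=> B [i _]; exact: string_events_measurable.
Qed.

Definition cell K i (w : Omega) : K.-tuple A := [tuple of mkseq (Xi i w) K].

Definition cell_event K i (t : K.-tuple A) : set Omega :=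
  [set w | cell K i w = t].

Let a0 : A := enum_val (Ordinal A0).

Lemma cell_eventE K i (t : K.-tuple A) : cell_event i t =
  \bigcap_(j in [set` iota 0 K]) [set w | Xi i w j = nth a0 t j].
Proof.
apply/seteqP; split=> w /=.
  move=> wt j; rewrite /= mem_iota add0n => /= jK.
  by rewrite -wt /cell/= nth_mkseq.
move=> h; apply: val_inj; apply: (@eq_from_nth _ a0) => /=.
  by rewrite size_mkseq size_tuple.
by move=> j; rewrite size_mkseq => jK; rewrite nth_mkseq// h//= mem_iota add0n.
Qed.

Lemma letter_event_mem i j (a : A) :
  letter_events (Xi i) j [set w | Xi i w j = a].
Proof. by exists [set a]. Qed.

Lemma cell_event_string K i (t : K.-tuple A) :
  string_events (Xi i) (cell_event i t).
Proof.
rewrite cell_eventE; apply: sigma_algebra_bigcap_seq => j _.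
by apply: sub_sigma_algebra; exists j => //; exact: letter_event_mem.
Qed.

Lemma prob_cell_event K i (t : K.-tuple A) :
  P (cell_event i t) = ((#|{: K.-tuple A}|%:R)^-1)%:E.
Proof.
rewrite cell_eventE (letters_independent model (i := i)) ?iota_uniq//; last first.
  by move=> j _; exact: letter_event_mem.
under eq_bigr do rewrite (letter_uniform model).
by rewrite prodEFin big_const_seq count_predT size_iota iter_mulr_1 exprVn
  card_tuple natrX.
Qed.

Section Words.
Context (K : nat).
Let T := {: K.-tuple A}.

(** The first [n] strings become one word over the alphabet of length-[K] prefixes, so that prefix
    counts are letter counts. *)
Definition word n (w : Omega) : n.-tuple (K.-tuple A) :=
  [tuple of mkseq (cell K ^~ w) n].

Let t0 : K.-tuple A := [tuple of nseq K a0].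

Definition word_event n (s : n.-tuple (K.-tuple A)) : set Omega :=
  [set w | word n w = s].

Lemma word_eventE n (s : n.-tuple (K.-tuple A)) : word_event s =
  \bigcap_(i in [set` iota 0 n]) cell_event i (nth t0 s i).
Proof.
apply/seteqP; split=> w /=.
  move=> wt j; rewrite /= mem_iota add0n => /= jK.
  by rewrite -wt /cell_event/= nth_mkseq.
move=> h; apply: val_inj; apply: (@eq_from_nth _ t0) => /=.
  by rewrite size_mkseq size_tuple.
by move=> j; rewrite size_mkseq => jK; rewrite nth_mkseq// h//= mem_iota add0n.
Qed.

Lemma word_event_family n (s : n.-tuple (K.-tuple A)) :
  family_events Xi (word_event s).
Proof.
rewrite word_eventE; apply: sigma_algebra_bigcap_seq => i _.
by apply: sub_sigma_algebra; exists i => //; exact: cell_event_string.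
Qed.

Lemma prob_word_event n (s : n.-tuple (K.-tuple A)) :
  P (word_event s) = ((#|T|%:R ^+ n)^-1)%:E.
Proof.
rewrite word_eventE (strings_independent model) ?iota_uniq//; last first.
  by move=> j _; exact: cell_event_string.
under eq_bigr do rewrite prob_cell_event.
by rewrite prodEFin big_const_seq count_predT size_iota iter_mulr_1 exprVn.
Qed.

Definition words_event n (q : pred (n.-tuple (K.-tuple A))) : set Omega :=
  [set w | q (word n w)].

Lemma words_eventE n (q : pred (n.-tuple (K.-tuple A))) :
  words_event q = \bigcup_(s in [set` enum q]) word_event s.
Proof.
apply/seteqP; split => [w qw|w [s]/=].
  by exists (word n w) => //=; rewrite mem_enum.
by rewrite mem_enum /words_event/= => qs ->.
Qed.

Lemma words_event_family n (q : pred (n.-tuple (K.-tuple A))) :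
  family_events Xi (words_event q).
Proof.
rewrite words_eventE bigcup_seq.
apply: (@bigsetU_measurable _ (g_sigma_algebraType _)) => s _.
exact: word_event_family.
Qed.

Lemma prob_words_event n (q : pred (n.-tuple (K.-tuple A))) :
  P (words_event q) = (#|q|%:R / #|T|%:R ^+ n)%:E.
Proof.
rewrite words_eventE measure_fin_bigcup//; last 2 first.
- by move=> s s' _ _ [w [/= <- <-]].
- by move=> s _; apply: family_events_measurable; exact: word_event_family.
rewrite -fsbig_seq ?enum_uniq//.
rewrite (eq_bigr (fun=> ((#|T|%:R ^+ n)^-1)%:E)) ; last first.
  by move=> s _; exact: prob_word_event.
by rewrite sumEFin big_const_seq count_predT -cardE iter_addr_0 mulr_natl.
Qed.

Lemma measurable_size l n : measurable [set w | N l w = n].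
Proof. exact: (measurable_funPTI (N l) (Y := [set n])). Qed.

Definition no_singleton_event l : set Omega :=
  [set w | singleton_free (word (N l w) w)].

(** The word has random length. On [N l = n] the length is fixed, and the condition becomes an event
    of the strings alone, independent of [N l]. *)
Lemma no_singleton_eventE l : no_singleton_event l =
  \bigcup_n ([set w | N l w = n] `&`
    words_event (fun s : n.-tuple _ => singleton_free s)).
Proof.
apply/seteqP; split => [w qw|w [n _ [/= <-]]//].
by exists (N l w).
Qed.

Lemma measurable_no_singleton_event l : measurable (no_singleton_event l).
Proof.
rewrite no_singleton_eventE; apply: bigcup_measurable => n _.
apply: measurableI; first exact: measurable_size.
by apply: family_events_measurable; exact: words_event_family.
Qed.

Lemma prob_no_singleton_event l : 0 < l -> P (no_singleton_event l) =
  ((1 - l / #|T|%:R * expR (- (l / #|T|%:R))) ^+ #|T|)%:E.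
Proof.
move=> l0; rewrite no_singleton_eventE measure_semi_bigcup//; last 3 first.
- move=> n; apply: measurableI; first exact: measurable_size.
  by apply: family_events_measurable; exact: words_event_family.
- by move=> i j _ _ [w [[/= <- _] [<- _]]].
- by rewrite -no_singleton_eventE; exact: measurable_no_singleton_event.
apply: cvg_lim => //.
have T0 : (0 < #|T|)%N by rewrite card_tuple expn_gt0 A0.
rewrite (_ : (fun n => _) = EFin \o series (fun n => poisson_pmf l n *
   (#|finset (fun s : n.-tuple (K.-tuple A) => singleton_free s)|%:R /
      #|T|%:R ^+ n))).
  apply: cvg_EFin; first by near=> n.
  exact: cvg_series_poisson_singleton_free.
apply/funext => n /=; rewrite /series/= -sumEFin; apply: eq_bigr => i _.
rewrite (size_independent model l0 [set i]); last exact: words_event_family.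
rewrite prob_words_event [RHS]EFinM; congr (_ * _)%E.
  exact: (size_poisson model).
by rewrite cardsE.
Unshelve. all: by end_near. Qed.

Definition nonempty_no_singleton_event l : set Omega :=
  [set w | (0 < N l w)%N /\ singleton_free (word (N l w) w)].

Lemma nonempty_no_singleton_eventE l :
  nonempty_no_singleton_event l = no_singleton_event l `\` [set w | N l w = 0%N].
Proof.
apply/seteqP; split => w /= [].
  by move=> N0 sf; split=> // w0; rewrite w0 in N0.
by move=> sf w0; split=> //; rewrite lt0n; exact/eqP.
Qed.

Lemma measurable_nonempty_no_singleton_event l :
  measurable (nonempty_no_singleton_event l).
Proof.
rewrite nonempty_no_singleton_eventE; apply: measurableD.
  exact: measurable_no_singleton_event.
exact: measurable_size.
Qed.

Lemma prob_nonempty_no_singleton_event l : 0 < l ->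
  P (nonempty_no_singleton_event l) = (nsp (#|A| ^ K) l)%:E.
Proof.
move=> l0; rewrite nonempty_no_singleton_eventE measureD; last 3 first.
- exact: measurable_no_singleton_event.
- exact: measurable_size.
- by rewrite ltey_eq fin_num_measure//; exact: measurable_no_singleton_event.
(* The empty word is singleton-free, so the whole event [N l = 0], of probability [e^(-l)], is
   subtracted. *)
rewrite setIidr => [|w/= N0]; last first.
  by rewrite /no_singleton_event/= N0; apply/forallP => t.
rewrite [X in (X - _)%E](prob_no_singleton_event l0).
rewrite [X in (_ - X)%E](size_poisson model l0) /poisson_pmf l0.
by rewrite expr0 fact0 invr1 !mul1r -EFinB /nsp card_tuple.
Qed.

Lemma no_singleton_sampleP l w :
  no_singleton (@sample R d Omega P A Xi N l w) K <->
  singleton_free (word (N l w) w).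
Proof.
have nuE (t : K.-tuple A) :
    nu (@sample R d Omega P A Xi N l w) t = count_mem t (word (N l w) w).
  rewrite /word/= /mkseq -val_enum_ord 2!count_map enumT.
  rewrite /nu cardE /enum_mem size_filter; apply: eq_count => i.
  by rewrite /= !inE /has_prefix size_tuple eq_sym -val_eqE.
split=> [h|/forallP h v vK].
  by apply/forallP => t; rewrite -nuE; apply: h; rewrite size_tuple.
by have := h (Tuple (introT eqP vK)); rewrite -nuE.
Qed.
End Words.

(** Removing the intersection over all levels encodes the last condition of [protected_rootP]. *)
Lemma protected_eventE k l : (0 < k)%N ->
  [set w : Omega | trie (@sample R d Omega P A Xi N l w) !=set0 /\
     protected (@sample R d Omega P A Xi N l w) k [::]] =
  nonempty_no_singleton_event k.-1 l `\`
    \bigcap_K nonempty_no_singleton_event K l.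
Proof.
move=> k0; apply/seteqP; split => w /=.
  move=> /(protected_rootP _ k0)[N0 /no_singleton_sampleP sf [K nsf]].
  split; first by split.
  by move=> /(_ K I)[_ /no_singleton_sampleP].
move=> [[N0 sf] h]; apply/protected_rootP => //; split => //.
  exact/no_singleton_sampleP.
apply: contra_notP h => hK K _; split=> //.
by apply/no_singleton_sampleP; apply: contrapT => nsf; apply: hK; exists K.
Qed.

(* This event contains the coincidences of strings, which leave a trie without
   leaves. *)
Lemma prob_singleton_free_at_all_levels l : (1 < #|A|)%N -> 0 < l ->
  P (\bigcap_K nonempty_no_singleton_event K l) = 0%E.
Proof.
move=> A1 l0; set Z := \bigcap_K _.
have mZ : measurable Z.
  apply: bigcap_measurable => // K _.
  exact: measurable_nonempty_no_singleton_event.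
have Zfin : P Z \is a fin_num by exact: fin_num_measure.
(* [nsp_le_inv] at [m = #|A| ^ K], weakened by [K < #|A| ^ K]. A positive [P Z] would then
   contradict the Archimedean property. *)
have Zle K : fine (P Z) * K%:R <= l ^+ 2 / 2.
  have AK : (0 < #|A| ^ K)%N by rewrite expn_gt0 A0.
  have h : fine (P Z) <= nsp (#|A| ^ K) l.
    rewrite -lee_fin fineK// -prob_nonempty_no_singleton_event//.
    apply: le_measure; rewrite ?inE//.
      exact: measurable_nonempty_no_singleton_event.
    by move=> w; apply.
  have := le_trans h (nsp_le_inv AK (ltW l0)).
  rewrite ler_pdivlMr ?ltr0n//; apply: le_trans.
  rewrite ler_wpM2l ?fine_ge0// ler_nat.
  by rewrite ltnW// ltn_expl.
apply/eqP; rewrite -(fineK Zfin) eqe -[_ == _]negbK; apply/negP => pn0.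
have p0 : 0 < fine (P Z) by rewrite lt0r pn0 fine_ge0.
have := Zle (Num.trunc (l ^+ 2 / 2 / fine (P Z))).+1.
by rewrite leNgt [ltRHS]mulrC -ltr_pdivrMr// truncnS_gt.
Qed.

Lemma f_protE k l : (1 < #|A|)%N -> (0 < k)%N -> 0 < l ->
  f_prot P Xi N k l = nsp (#|A| ^ k.-1) l.
Proof.
move=> A1 k0 l0; rewrite /f_prot protected_eventE//.
have mn K := measurable_nonempty_no_singleton_event K l.
have mZ : measurable (\bigcap_K nonempty_no_singleton_event K l).
  by apply: bigcap_measurable => // K _; exact: mn.
rewrite measureD//; last by rewrite ltey_eq fin_num_measure.
rewrite setIidr; last by move=> w; apply.
rewrite [X in (_ - X)%E](prob_singleton_free_at_all_levels A1 l0) sube0.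
by rewrite [X in fine X](prob_nonempty_no_singleton_event _ l0).
Qed.

Lemma f_prot_starE k : (1 < #|A|)%N -> (0 < k)%N ->
  f_prot_star P Xi N k = fine (nsp_integral R (#|A| ^ k.-1)).
Proof.
move=> A1 k0; rewrite /f_prot_star /Rintegral /nsp_integral; congr fine.
apply: eq_integral => l; rewrite inE/= in_itv/= andbT => l0.
by rewrite f_protE.
Qed.
End PoissonTrie.

(** * The limit along pairs of alphabet size and protection level *)

Theorem theorem4p15 (R : realType)
    (d : nat -> measure_display)
    (Omega : forall r : nat, measurableType (d r))
    (P : forall r : nat, probability (Omega r) R)
    (A : nat -> finType)
    (Xi : forall r : nat, nat -> Omega r -> nat -> A r)
    (N : forall r : nat, R -> {RV (P r) >-> nat})
    (cardA : forall r : nat, (2 <= r)%N -> #|A r| = r)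
    (model : forall r : nat, (2 <= r)%N ->
      poisson_string_model (Xi r) (N r)) :
  (forall r k : nat -> nat,
     (forall j, (2 <= r j)%N) -> (forall j, (2 <= k j)%N) ->
     maxn (r j) (k j) @[j --> \oo] --> \oo ->
     asymp_equiv
       (fun j => f_prot_star (P (r j)) (Xi (r j)) (N (r j)) (k j))
       (fun j => 1 / (2 * (r j)%:R ^+ (k j - 1)))) /\
  asymp_equiv (fun k => f_prot_star (P 2%N) (Xi 2%N) (N 2%N) k)
    (fun k => 2 ^- k).
Proof.
have starE (r k : nat) : (2 <= r)%N -> (2 <= k)%N ->
    f_prot_star (P r) (Xi r) (N r) k = fine (nsp_integral R (r ^ k.-1)).
  move=> r2 k2; have A1 : (1 < #|A r|)%N by rewrite cardA.
  by rewrite (f_prot_starE (model r r2)) ?cardA// ltnW.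
have main (r k : nat -> nat) :
     (forall j, (2 <= r j)%N) -> (forall j, (2 <= k j)%N) ->
     maxn (r j) (k j) @[j --> \oo] --> \oo ->
     asymp_equiv
       (fun j => f_prot_star (P (r j)) (Xi (r j)) (N (r j)) (k j))
       (fun j => 1 / (2 * (r j)%:R ^+ (k j - 1))).
  move=> r2 k2 rk; pose m j := (r j ^ (k j).-1)%N.
  (* [r <= r^(k-1)] since [k >= 2], and [k <= 2^(k-1) <= r^(k-1)]; hence [m] tends to infinity
     whichever of [r] and [k] grows. *)
  have rkm j : (maxn (r j) (k j) <= m j)%N.
    rewrite geq_max; apply/andP; split.
      rewrite -[X in (X <= _)%N]expn1 leq_exp2l//.
      by rewrite -ltnS prednK// ltnW.
    have kk : (k j <= 2 ^ (k j).-1)%N.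
      have k0 : (0 < k j)%N by exact: ltnW.
      by rewrite -{1}(prednK k0); apply: ltn_expl.
    apply: leq_trans kk _.
    by rewrite leq_exp2r// -ltnS prednK// ltnW.
  have mcvg : m j @[j --> \oo] --> \oo.
    move=> B [n _ nB]; have [p _ pB] := rk [set i | (n <= i)%N] (nbhs_infty_ge n).
    exists p => // j pj; apply: nB => /=.
    by apply: leq_trans (rkm j); exact: pB.
  rewrite /asymp_equiv (_ : (fun j => _) = fun j =>
      2 * ((m j)%:R * fine (nsp_integral R (m j)))); last first.
    apply/funext => j; rewrite starE// -/(m j) subn1 -natrX -/(m j).
    have M0 : (0 : R) < (m j)%:R by rewrite ltr0n expn_gt0 ltnW.
    by field; lra.
  rewrite -[X in _ --> X](@divff _ (2 : R))//.
  apply: (@cvgMr _ _ _ _ _ _ (2^-1 : R)).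
  exact: (@cvg_comp _ _ _ m (fun i => i%:R * fine (nsp_integral R i))
    _ _ _ mcvg (@cvg_nsp_integral R)).
split => //.
(* The general statement asks for [k j >= 2] at every index, so the binary case is read along
   [j + 2], where [2 * 2^(k-1) = 2^k]. *)
rewrite /asymp_equiv -(cvg_shiftn 2).
have k2 j : (2 <= j + 2)%N by rewrite leq_addl.
have := main (fun=> 2%N) (fun j => (j + 2)%N) (fun=> leqnn 2) k2.
rewrite /asymp_equiv (_ : (fun j : nat => _ / (1 / _)) = (fun j =>
  f_prot_star (P 2%N) (Xi 2%N) (N 2%N) (j + 2) / 2 ^- (j + 2))); last first.
  by apply/funext => j; rewrite -exprS addn2 subn1 div1r.
apply; under eq_fun => j do rewrite (maxn_idPr (k2 j)).
exact: cvg_addnr.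
Qed.
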